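(* Let $A\in\mathbb{R}^{m\times n}$, $b\in\mathbb{R}^m$. Let $\phi:[0,\infty)\to\mathbb{R}$ be lower semi-continuous and increasing on $[0,\infty)$ with $\phi(0)=0$, and suppose that $$\phi(s)\ge\phi(t)-\phi(|s-t|)\qquad\forall s,t\ge0.$$ Let $x^*\in\mathbb{R}^n$ be such that $Ax^*=b$. Assume that the global null space property GNSP($r$,$\phi$) holds for the system $Ax=b$ at $x^*$ for some integer $r$ with $0\le r\le\|x^*\|_0$ and $r\le n-1$. Then $x^*$ is a unique global minimizer of the problem $$\min_{x\in\mathbb{R}^n}\Big\{\sum_{i=r+1}^n\phi(|x|_{[i]}):\ Ax-b=0\Big\}$$ with such $\phi$ and $r$.
   Context: $|x|_{[i]}$ denotes the $i$th largest element of $\{|x_1|,\ldots,|x_n|\}$ (counted with multiplicity); $\|x\|_0$ is the number of nonzero entries; $\mathcal N(A)$ is the null space of $A$. ''Increasing'' is meant in the weak sense. Let $\mathcal I_0(x)=\{i:x_i=0\}$ and $\mathcal I_0^{c}(x)=\{i:x_i\ne0\}$. Definition (global null space property). GNSP($r$,$\phi$) holds for the system $Ax=b$ at a solution $x^*$ with $\|x^*\|_0\ge r$ if $$\sum_{i\in J_0}\phi(|h_i|)-\sum_{i\in J_1}\phi(|h_i|)>0\qquad\forall h\in\mathcal N(A)\setminus\{0\}$$ holds for every $(J_0,J_1)\in\widetilde{\mathcal J}$, where $$\widetilde{\mathcal J}=\{(J_0,J_1):\ J_0\subseteq\mathcal I_0(x^* ),\ J_1\subseteq\mathcal I_0^{c}(x^*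 ),\ |J_0|+|J_1|=n-r\}.$$ *)

(* Defs.v *)
From mathcomp Require Import all_boot all_order all_algebra.
From mathcomp Require Import all_classical reals ereal topology normedtype.

Set Implicit Arguments.
Unset Strict Implicit.
Unset Printing Implicit Defensive.

Import Order.TTheory GRing.Theory Num.Theory.
Import numFieldNormedType.Exports.

Local Open Scope ring_scope.

Section SparseRecovery.
Context {R : realType} {n : nat}.
Implicit Types (x h : 'cV[R]_n) (phi : R -> R) (r : nat).

(* [|x|_[i]]; the index [i] is 1-based, [1 <= i <= n]. *)
Definition abs_kth_largest x (i : nat) : R :=
  nth 0 (sort >=%R [seq `|x j 0| | j <- enum 'I_n]) i.-1.

Definition I0 x : {set 'I_n} := [set i | x i 0 == 0].

Definition I0c x : {set 'I_n} := [set i | x i 0 != 0].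

Definition l0norm x : nat := #|I0c x|.

Definition null_space m (A : 'M[R]_(m, n)) : set 'cV[R]_n :=
  [set h | A *m h = 0]%classic.

Definition Jtilde r x (J : {set 'I_n} * {set 'I_n}) : Prop :=
  [/\ J.1 \subset I0 x, J.2 \subset I0c x & (#|J.1| + #|J.2|)%N = (n - r)%N].

(* The first two clauses are the standing requirements under which the
   property is formulated: [x] solves [A x = b] and [||x||_0 >= r]. *)
Definition GNSP m (A : 'M[R]_(m, n)) (b : 'cV[R]_m) r phi x : Prop :=
  [/\ A *m x = b,
      (r <= l0norm x)%N &
      forall J0 J1 : {set 'I_n}, Jtilde r x (J0, J1) ->
      forall h, null_space A h -> h <> 0 ->
        \sum_(i in J0) phi `|h i 0| - \sum_(i in J1) phi `|h i 0| > 0].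

Definition objective r phi x : R :=
  \sum_(r.+1 <= i < n.+1) phi (abs_kth_largest x i).

Definition feasible m (A : 'M[R]_(m, n)) (b : 'cV[R]_m) : set 'cV[R]_n :=
  [set x | A *m x - b = 0]%classic.

Definition global_minimizer (f : 'cV[R]_n -> R) (S : set 'cV[R]_n) x : Prop :=
  S x /\ forall y, S y -> f x <= f y.

End SparseRecovery.

(* A function on [0, +oo) is represented by a total function [phi : R -> R]
   whose values at negative reals are irrelevant. Lower semicontinuity is with
   respect to the subspace topology; in [subspace D] the points outside [D] are
   isolated, so nothing is required of [phi] there. *)
Definition lsc_on_nonneg {R : realType} (phi : R -> R) : Prop :=
  @lower_semicontinuous (subspace (`[0, +oo[%classic : set R)) R (EFin \o phi).

(* Main.v *)
Require Import Defs.
From mathcomp Require Import all_boot all_order all_algebra.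
From mathcomp Require Import all_classical reals ereal topology normedtype.

Set Implicit Arguments.
Unset Strict Implicit.
Unset Printing Implicit Defensive.

Import Order.TTheory GRing.Theory Num.Theory.
Import numFieldNormedType.Exports.

Local Open Scope ring_scope.

(** The objective is the least value of the sums of [phi |x_i|] over index
    sets of size [n - r], and it is attained at a set [S] of positions of the
    [n - r] smallest entries.  Let [y <> xstar] be feasible, [h = y - xstar]
    and [S] such a set for [y].  Split [S] into the part [J0] where [xstar]
    vanishes and the part [J1] where it does not.  On [J0], [y] and [h]
    coincide; on [J1], subadditivity gives
    [phi |y_i| >= phi |xstar_i| - phi |h_i|].  Since [phi 0 = 0], summing yields

      [objective y >= \sum_(i in S) phi |xstar_i|
                    + (\sum_(i in J0) phi |h_i| - \sum_(i in J1) phi |h_i|)].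

    The bracket is positive by the null space property at [(J0, J1)], and the
    first sum is at least [objective xstar] by minimality
    ([le_objective_sum]).  So [xstar] is strictly better than every other
    feasible point, which gives optimality and uniqueness at once. *)

(** Shifting [g] by [c] makes it nonpositive on [T] and nonnegative off [T];
    equal cardinality makes the shift contribute the same to both sums. *)
Lemma le_sum_threshold (R : realDomainType) (I : finType) (g : I -> R) (c : R)
    (T S : {set I}) :
  #|T| = #|S| -> {in T, forall i, g i <= c} ->
  (forall i, i \notin T -> c <= g i) ->
  \sum_(i in T) g i <= \sum_(i in S) g i.
Proof.
move=> cardTS g_le_c c_le_g.
suff: \sum_(i in T) (g i - c) <= \sum_(i in S) (g i - c).
  by rewrite !big_split /= !sumr_const cardTS lerD2r.
rewrite (big_setID S) /= [leRHS](big_setID T) /= finset.setIC lerD2l.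
apply: (@le_trans _ _ 0).
  by apply: sumr_le0 => i /setDP[iT _]; rewrite subr_le0 g_le_c.
by apply: sumr_ge0 => i /setDP[_ iT]; rewrite subr_ge0 c_le_g.
Qed.

Section Objective.
Context {R : realType} {n : nat} (phi : R -> R) (r : nat).
Implicit Types x : 'cV[R]_n.
Hypothesis phi_incr : forall s t : R, 0 <= s -> s <= t -> phi s <= phi t.
Hypothesis r_lt_n : (r < n)%N.

(** Sorting the indices instead of the values turns the tail of the sorted
    list of moduli into a set [T] of indices.  The entry of rank [r + 1]
    separates [T] from its complement, so that [T] minimizes the sum. *)
Lemma objective_minimal_set x : exists T : {set 'I_n},
  [/\ #|T| = (n - r)%N, objective r phi x = \sum_(i in T) phi `|x i 0| &
      forall S : {set 'I_n}, #|S| = (n - r)%N ->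
        \sum_(i in T) phi `|x i 0| <= \sum_(i in S) phi `|x i 0|].
Proof.
pose v (i : 'I_n) : R := `|x i 0|.
pose e := sort (relpre v >=%R) (enum 'I_n).
have sz_e : size e = n by rewrite size_sort size_enum_ord.
have uniq_e : uniq e by rewrite sort_uniq enum_uniq.
have mem_e i : i \in e by rewrite mem_sort mem_enum.
pose i0 := Ordinal r_lt_n.
have v_anti j k : (j <= k)%N -> (k < n)%N -> v (nth i0 e k) <= v (nth i0 e j).
  move=> jk kn.
  have srt : sorted (relpre v >=%R) e.
    by apply: sort_sorted => i j'; exact: le_total.
  apply: (@sorted_leq_nth _ (relpre v >=%R) _ _ i0 e srt) => //.
  - by move=> a b c ba ac; exact: le_trans ac ba.
  - by move=> a; exact: lexx.
  - by rewrite inE sz_e (leq_ltn_trans jk).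
  - by rewrite inE sz_e.
pose T := [set i in drop r e].
have cardT : #|T| = (n - r)%N.
  by rewrite cardsE (card_uniqP _) ?drop_uniq// size_drop sz_e.
exists T; split => //.
  rewrite /objective big_add1 /=.
  have -> : \sum_(i in T) phi (v i) = \sum_(i <- drop r e) phi (v i).
    rewrite big_uniq ?drop_uniq//=.
    by apply: eq_bigl => i; rewrite inE.
  rewrite (big_nth i0) size_drop sz_e -{1}[r]add0n big_addn.
  apply: eq_big_nat => i /andP[_ i_lt].
  rewrite /abs_kth_largest /= -/v sort_map (nth_map i0).
    by rewrite nth_drop addnC.
  by rewrite -/e sz_e addnC -ltn_subRL.
move=> S cardS.
apply: (@le_sum_threshold _ _ _ (phi (v (nth i0 e r)))) => [|i|i].
- by rewrite cardT.
- rewrite inE => /(nthP i0)[k]; rewrite size_drop sz_e => k_lt <-.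
  rewrite nth_drop; apply: phi_incr; first exact: normr_ge0.
  by apply: v_anti; rewrite ?leq_addr// -ltn_subRL.
- rewrite inE => iT; apply: phi_incr; first exact: normr_ge0.
  have: i \in take r e.
    by have := mem_e i; rewrite -{1}(cat_take_drop r e) mem_cat (negPf iT) orbF.
  move=> /(nthP i0)[k]; rewrite size_takel ?sz_e; last exact: ltnW.
  move=> k_lt <-; rewrite nth_take//.
  by apply: v_anti => //; exact: ltnW.
Qed.

Lemma le_objective_sum x (S : {set 'I_n}) : #|S| = (n - r)%N ->
  objective r phi x <= \sum_(i in S) phi `|x i 0|.
Proof. by have [T [_ -> minT]] := objective_minimal_set x; exact: minT. Qed.

End Objective.

(** [phi_sub] compares moduli, so the reverse triangle inequality is what
    brings in the modulus of the difference. *)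
Lemma subadditive_norm_lower_bound (R : realDomainType) (phi : R -> R) (u w : R)
    (phi_incr : forall s t : R, 0 <= s -> s <= t -> phi s <= phi t)
    (phi_sub : forall s t : R, 0 <= s -> 0 <= t ->
      phi s >= phi t - phi `|s - t|) :
  phi `|u| - phi `|w - u| <= phi `|w|.
Proof.
apply: le_trans (phi_sub _ _ (normr_ge0 w) (normr_ge0 u)).
by rewrite lerD2l lerN2 phi_incr// ler_dist_dist.
Qed.

Theorem theorem4p6 (R : realType) (m n : nat) (A : 'M[R]_(m, n))
    (b : 'cV[R]_m) (phi : R -> R) (xstar : 'cV[R]_n) (r : nat)
    (phi_lsc : lsc_on_nonneg phi)
    (phi_incr : forall s t : R, 0 <= s -> s <= t -> phi s <= phi t)
    (phi0 : phi 0 = 0)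
    (phi_sub : forall s t : R, 0 <= s -> 0 <= t ->
      phi s >= phi t - phi `|s - t|)
    (xstar_sol : A *m xstar = b)
    (r_le_l0 : (r <= l0norm xstar)%N)
    (r_lt_n : (r < n)%N)
    (xstar_gnsp : GNSP A b r phi xstar) :
  unique (global_minimizer (objective r phi) (feasible A b)) xstar.
Proof.
have [_ _ gnsp] := xstar_gnsp.
have better y : feasible A b y -> y <> xstar ->
    objective r phi xstar < objective r phi y.
  move=> feas_y y_neq.
  have [S [cardS -> _]] := objective_minimal_set phi_incr r_lt_n y.
  apply: le_lt_trans (le_objective_sum phi_incr r_lt_n xstar cardS) _.
  pose h := y - xstar.
  have h_null : null_space A h.
    by rewrite /null_space /= mulmxBr xstar_sol.
  have h_neq0 : h <> 0 by move/eqP; rewrite subr_eq0 => /eqP.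
  have cover : S :\: I0 xstar = S :&: I0c xstar.
    by apply/setP => i; rewrite !inE andbC.
  have JS : Jtilde r xstar (S :&: I0 xstar, S :&: I0c xstar).
    split; rewrite /= ?subsetIr// -cardS -cover; exact: cardsID.
  rewrite (big_setID (I0 xstar)) /= [ltRHS](big_setID (I0 xstar)) /= cover.
  have -> : \sum_(i in S :&: I0 xstar) phi `|xstar i 0| = 0.
    by apply: big1 => i /setIP[_]; rewrite inE => /eqP->; rewrite normr0.
  have := gnsp _ _ JS _ h_null h_neq0.
  have -> : \sum_(i in S :&: I0 xstar) phi `|h i 0|
          = \sum_(i in S :&: I0 xstar) phi `|y i 0|.
    apply: eq_bigr => i /setIP[_]; rewrite inE => /eqP xi0.
    by rewrite !mxE xi0 subr0.
  rewrite add0r subr_gt0 => gap.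
  rewrite -ltrBlDr; apply: le_lt_trans gap.
  rewrite lerBlDr -lerBlDl -sumrB.
  by apply: ler_sum => i _; rewrite !mxE; exact: subadditive_norm_lower_bound.
have feas_xstar : feasible A b xstar.
  by rewrite /feasible /= xstar_sol subrr.
split.
  split=> // y feas_y; case: (eqVneq y xstar) => [->//|/eqP y_neq].
  exact/ltW/better.
move=> y [feas_y y_min]; apply/eqP; rewrite eq_sym.
apply/negPn/negP => /eqP y_neq.
by have := better y feas_y y_neq; rewrite ltNge y_min.
Qed.
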